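(* Let $X$ and $U$ be non-trivial complex Hilbert spaces with $\dim U=1$, let $A_s\in\mathcal L(X)$ and $B_s\in\mathcal L(U,X)$, and let $x_1=(x_1(k))_{k\in\mathbb N}$, $x_0=(x_0(k))_{k\in\mathbb N}$ be Bessel sequences in $X$ and $u_0=(u_0(k))_{k\in\mathbb N}$ a Bessel sequence in $U$ such that $x_1(k)=A_sx_0(k)+B_su_0(k)$ for all $k\in\mathbb N$. Let $\Xi_1,\Xi_0\in\mathcal L(\ell^2(\mathbb N),X)$ and $\Upsilon_0\in\mathcal L(\ell^2(\mathbb N),U)$ be the synthesis operators associated with $x_1,x_0,u_0$, respectively. Assume either that $\operatorname{Ker}\Xi_0\setminus\operatorname{Ker}\Upsilon_0\ne\emptyset$ or that the data $(x_1,x_0,u_0)$ are not informative for system identification. Let $\gamma\in(0,1)$, and call a linear operator $\Xi_0^\dagger$ from $X$ to $\ell^2(\mathbb N)$ with domain $D(\Xi_0^\dagger)=\operatorname{Ran}\Xi_0$ admissible if $\overline{\operatorname{Ran}\Xi_0}=X$ and a) $\Xi_0\Xi_0^\dagger x=x$ for all $x\in D(\Xi_0^\dagger)$; b) $\Upsilon_0\Xi_0^\dagger$ can be extended to an operator in $\mathcal L(X,U)$; and c) $\Xi_1\Xi_0^\dagger$ can be extended to an operator in $\mathcal L(X)$, and this extension is power stable with decay rate $\gamma$. Then for every admissible $\Xi_0^\dagger$, the extension of $\Upsilon_0\Xi_0^\dagger$ to an operator in $\mathcal L(X,U)$ is a stabilizing gain with decay rate $\gamma$ for $(x_1,x_0,u_0)$.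 Conversely, every stabilizing gain with decay rate $\gamma$ for $(x_1,x_0,u_0)$ is the extension of $\Upsilon_0\Xi_0^\dagger$ for some admissible $\Xi_0^\dagger$.
   Context: $\mathcal L(Y,Z)$ denotes the bounded linear operators from $Y$ to $Z$, $\mathcal L(Y)=\mathcal L(Y,Y)$; $\mathbb N=\{1,2,\dots\}$, $\mathbb N_0=\mathbb N\cup\{0\}$. A sequence $(\eta_k)_{k\in\mathbb N}$ in a Hilbert space $Y$ is a Bessel sequence if there is $\alpha>0$ with $\sum_{k=1}^\infty|\langle y,\eta_k\rangle|^2\le\alpha\|y\|^2$ for all $y\in Y$. Its synthesis operator is the bounded operator $\ell^2(\mathbb N)\to Y$, $w=(w_k)_{k\in\mathbb N}\mapsto\sum_{k=1}^\infty w_k\eta_k$. For $\gamma\in(0,1)$, a bounded operator $F$ is power stable with decay rate $\gamma$ if there is $M\ge1$ with $\|F^k\|\le M\gamma^k$ for all $k\in\mathbb N_0$. Define $\Sigma_{\mathrm{is}}:=\{(A,B)\in\mathcal L(X)\times\mathcal L(U,X): x_1(k)=Ax_0(k)+Bu_0(k)\ \text{for all }k\in\mathbb N\}$, and for $K\in\mathcal L(X,U)$, $M\ge1$, $\gamma>0$, $\Sigma_{K,M,\gamma}:=\{(A,B)\in\mathcal L(X)\times\mathcal L(U,X):\|(A+BK)^k\|\le M\gamma^k\ \text{for all }k\in\mathbb N_0\}$. The data are informative for system identification if $\Sigma_{\mathrm{is}}=\{(A_s,B_s)\}$. For $\gamma\in(0,1)$, an operator $K\in\mathcal L(X,U)$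 is a stabilizing gain with decay rate $\gamma$ for $(x_1,x_0,u_0)$ if $\Sigma_{\mathrm{is}}\subseteq\Sigma_{K,M,\gamma}$ for some $M\ge1$. *)

(* Defs.v *)
From HB Require Import structures.
From mathcomp Require Import all_boot all_order all_algebra.
From mathcomp Require Import all_classical all_reals all_analysis.
From mathcomp Require Import complex ring.

Set Implicit Arguments.
Unset Strict Implicit.
Unset Printing Implicit Defensive.

Import Order.TTheory GRing.Theory Num.Theory.
Import numFieldNormedType.Exports.

Local Open Scope classical_set_scope.
Local Open Scope ring_scope.

(* Complex Hilbert spaces over R[i]; the inner product is linear in its first
   argument and conjugate-linear in its second one. *)
HB.mixin Record CompleteNormedModule_isHilbert (R : realType) X
    & CompleteNormedModule R[i] X := {
  inner : {dot X for @Num.conj R[i]} ;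
  inner_normE : forall x : X, inner x x = `|x| ^+ 2
}.

#[short(type="hilbertType")]
HB.structure Definition Hilbert (R : realType) :=
  {X of CompleteNormedModule_isHilbert R X & CompleteNormedModule R[i] X}.

Section Norms.
Context {R : realType}.

(* The library norm on a space over R[i] takes its (nonnegative real) values in
   R[i]; rnorm is the same number, in R. On R[i] itself it is the modulus. *)
Definition rnorm {V : normedZmodType R[i]} (v : V) : R := complex.Re `|v|.

(* L(Y, Z) *)
Definition bounded_op {Y Z : normedModType R[i]} : set (Y -> Z) :=
  [set T | linear T /\
    exists c : R, forall y, rnorm (T y) <= c * rnorm y].

(* The operator norm; a supremum of a nonempty bounded set for T in L(Y, Z). *)
Definition opnorm {Y Z : normedModType R[i]} (T : Y -> Z) : R :=
  sup [set rnorm (T y) | y in [set y : Y | rnorm y <= 1]].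

Definition nontrivial (V : normedModType R[i]) := exists v : V, v != 0.

Definition one_dimensional (V : normedModType R[i]) :=
  exists2 e : V, e != 0 & forall v : V, exists a : R[i], v = a *: e.

Definition ker {V W : lmodType R[i]} (T : V -> W) : set V :=
  [set v | T v = 0].

End Norms.

(* The space l^2(N) of square-summable complex sequences. In all sequences, the
   index k : nat stands for the index k + 1 in N = {1, 2, ...}. *)
Section EllTwo.
Context {R : realType}.

Definition square_summable : {pred nat -> R[i]^o} :=
  [pred w | `[< (\sum_(0 <= k <oo) (rnorm (w k) ^+ 2)%:E < +oo)%E >]].

Lemma square_summable_submod_closed : submod_closed square_summable.
Proof.
split.
  apply/asboolP; rewrite eseries0 ?ltry// => i _ _.
  by rewrite /rnorm normr0 expr0n.
move=> a v w /asboolP v2 /asboolP w2; apply/asboolP.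
have rnorm_ge0 (z : R[i]) : 0 <= rnorm z.
  by have := normr_ge0 z; rewrite lecE => /andP[].
have sq_ge0 (u : nat -> R[i]) k : (0 <= (rnorm (u k) ^+ 2)%:E)%E.
  by rewrite lee_fin sqr_ge0.
have rnormK (z : R[i]) : (rnorm z)%:C%C = `|z|.
  by rewrite /rnorm RRe_real// normr_real.
pose c := (2 * rnorm a ^+ 2)%:E.
have c_ge0 : (0 <= c)%E by rewrite lee_fin mulr_ge0// sqr_ge0.
apply: (@le_lt_trans _ _ (\sum_(0 <= k <oo)
    (c * (rnorm (v k) ^+ 2)%:E + 2%:E * (rnorm (w k) ^+ 2)%:E))%E).
  apply: lee_nneseries => [k _ _|k _]; first exact: sq_ge0.
  rewrite -!EFinM -EFinD lee_fin -mulrA -exprMn -mulrDr.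
  have -> : rnorm a * rnorm (v k) = rnorm (a * v k).
    by apply: (@complexI R); rewrite rmorphM/= !rnormK normrM.
  have le_D : rnorm (a * v k + w k) <= rnorm (a * v k) + rnorm (w k).
    by rewrite -lecR rmorphD/= !rnormK ler_normD.
  rewrite (@le_trans _ _ ((rnorm (a * v k) + rnorm (w k)) ^+ 2))//.
    by rewrite ler_sqr// nnegrE ?addr_ge0.
  rewrite -subr_ge0 (_ : _ - _ = (rnorm (a * v k) - rnorm (w k)) ^+ 2).
    exact: sqr_ge0.
  by ring.
rewrite nneseriesD; [|by move=> k _ _; rewrite mule_ge0|
  by move=> k _ _; rewrite mule_ge0// lee_fin].
rewrite !nneseriesZl; [|by move=> k _; exact: sq_ge0..].
by rewrite lte_add_pinfty// lte_mul_pinfty// lee_fin.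
Qed.

HB.instance Definition _ := GRing.isSubmodClosed.Build R[i] (nat -> R[i]^o)
  square_summable square_summable_submod_closed.

End EllTwo.

Record ell2 (R : realType) := Ell2 {
  ell2_val :> nat -> R[i]^o ;
  _ : ell2_val \in square_summable
}.

Section EllTwoLmodule.
Variable R : realType.
HB.instance Definition _ := [isSub for @ell2_val R].
HB.instance Definition _ := [Choice of ell2 R by <:].
HB.instance Definition _ := [SubChoice_isSubLmodule of ell2 R by <:].
End EllTwoLmodule.

Section Bessel.
Context {R : realType} {Y : hilbertType R}.

Definition bessel (eta : nat -> Y) := exists2 alpha : R, 0 < alpha &
  forall y, (\sum_(0 <= k <oo) (rnorm (inner y (eta k)) ^+ 2)%:E <=
             (alpha * rnorm y ^+ 2)%:E)%E.

(* For a Bessel sequence the series converges for all w in l^2(N), and the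
   synthesis operator is bounded; neither fact is built into the definition. *)
Definition synthesis (eta : nat -> Y) (w : ell2 R) : Y :=
  limn (series (fun k => w k *: eta k)).

End Bessel.

Section PartialOperators.
Context {R : realType}.

(* An operator with domain a subspace D of V is encoded as a function on V whose
   values outside D are irrelevant. *)
Definition linear_on {V W : lmodType R[i]} (D : set V) (T : V -> W) :=
  forall (a : R[i]) x y, D x -> D y -> T (a *: x + y) = a *: T x + T y.

(* F in L(Y, Z) is an extension of the operator T with domain D. *)
Definition bounded_extension {Y Z : normedModType R[i]} (D : set Y)
    (T F : Y -> Z) :=
  bounded_op F /\ forall y, D y -> F y = T y.

End PartialOperators.

Section DataDrivenStabilization.
Context {R : realType} {X U : hilbertType R}.
Implicit Types (A F : X -> X) (B : U -> X) (K : X -> U) (M gamma : R).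

Definition power_stable gamma F := exists2 M, 1 <= M &
  forall k, opnorm (iter k F) <= M * gamma ^+ k.

Definition Sigma_is (x1 x0 : nat -> X) (u0 : nat -> U) : set ((X -> X) * (U -> X)) :=
  [set AB | [/\ bounded_op AB.1, bounded_op AB.2 &
    forall k, x1 k = AB.1 (x0 k) + AB.2 (u0 k)]].

Definition Sigma_stab K M gamma : set ((X -> X) * (U -> X)) :=
  [set AB | [/\ bounded_op AB.1, bounded_op AB.2 &
    forall k, opnorm (iter k (AB.1 \+ (AB.2 \o K))) <= M * gamma ^+ k]].

(* A and B are the operators of the system that generated the data. *)
Definition informative_for_identification A B
    (x1 x0 : nat -> X) (u0 : nat -> U) :=
  Sigma_is x1 x0 u0 = [set (A, B)].

Definition stabilizing_gain gamma (x1 x0 : nat -> X) (u0 : nat -> U) K :=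
  bounded_op K /\
  exists2 M, 1 <= M & Sigma_is x1 x0 u0 `<=` Sigma_stab K M gamma.

Definition admissible gamma (Xi1 Xi0 : ell2 R -> X) (Ups0 : ell2 R -> U)
    (Xi0d : X -> ell2 R) :=
  [/\ linear_on (range Xi0) Xi0d,
      closure (range Xi0) = setT,
      forall x, range Xi0 x -> Xi0 (Xi0d x) = x,
      exists K, bounded_extension (range Xi0) (Ups0 \o Xi0d) K &
      exists2 F, bounded_extension (range Xi0) (Xi1 \o Xi0d) F &
        power_stable gamma F].

End DataDrivenStabilization.

(* Main.v *)
Require Import Defs.
From mathcomp Require Import all_boot all_order all_algebra.
From mathcomp Require Import all_classical all_reals all_analysis.
From mathcomp Require Import complex.
From mathcomp Require Import ring lra.

Import Order.TTheory GRing.Theory Num.Theory.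
Import numFieldNormedType.Exports.

Local Open Scope classical_set_scope.
Local Open Scope ring_scope.

Set Implicit Arguments.
Unset Strict Implicit.

(** Applied to the data, the synthesis operators satisfy Xi1 = A Xi0 + B Ups0 for
    every (A, B) in Sigma_is. If Xi0d is admissible and K extends Ups0 Xi0d, then
    A + BK and the extension of Xi1 Xi0d agree on the dense range of Xi0, hence
    everywhere, so that A + BK does not depend on (A, B).

    Conversely, let K be a stabilizing gain. If L1 x0(k) + L2 u0(k) = 0 for all k,
    then (As + t L1, Bs + t L2) is in Sigma_is for all real t, and the bound on
    the norm of As + Bs K + t (L1 + L2 K), uniform in t, forces L1 + L2 K = 0.
    With L2 = 0 and L1 = <., z> z, this excludes a nonzero z orthogonal to the
    range of Xi0, which is therefore dense. If the data are not informative,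
    there is such a pair with L2 <> 0; as dim U = 1, L2 is injective, and
    L2 (u0(k) - K x0(k)) = 0 gives Ups0 = K Xi0. If instead Ups0 w0 <> 0 for some
    w0 in Ker Xi0, adding a multiple of w0 to w enforces Ups0 w = K Xi0 w without
    changing Xi0 w. In both cases Xi0 maps N = {w | Ups0 w = K Xi0 w} onto its
    whole range, and Xi0d is an algebraic linear section of Xi0 with values in N,
    obtained from Zorn's lemma. *)

(** * The real-valued norm, and convergence and closure in terms of it *)

Section RealNorm.
Context {R : realType}.

Lemma rnorm_ge0 (V : normedZmodType R[i]) (v : V) : 0 <= rnorm v.
Proof. by have := normr_ge0 v; rewrite lecE => /andP[]. Qed.

Lemma rnormE (V : normedZmodType R[i]) (v : V) : (rnorm v)%:C%C = `|v|.
Proof. by rewrite /rnorm RRe_real// normr_real. Qed.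

Lemma rnorm0 (V : normedZmodType R[i]) : rnorm (0 : V) = 0.
Proof. by rewrite /rnorm normr0. Qed.

Lemma rnorm0_eq0 (V : normedZmodType R[i]) (v : V) : rnorm v = 0 -> v = 0.
Proof. by move=> v0; apply/eqP; rewrite -normr_eq0 -rnormE v0. Qed.

Lemma rnormN (V : normedZmodType R[i]) (v : V) : rnorm (- v) = rnorm v.
Proof. by rewrite /rnorm normrN. Qed.

Lemma rnormB_sym (V : normedZmodType R[i]) (v w : V) :
  rnorm (v - w) = rnorm (w - v).
Proof. by rewrite /rnorm distrC. Qed.

Lemma ler_rnormD (V : normedZmodType R[i]) (v w : V) :
  rnorm (v + w) <= rnorm v + rnorm w.
Proof. by rewrite -lecR rmorphD/= !rnormE ler_normD. Qed.

Lemma rnormZ (V : normedModType R[i]) (a : R[i]) (v : V) :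
  rnorm (a *: v) = rnorm a * rnorm v.
Proof. by apply: complexI; rewrite rmorphM/= !rnormE normrZ. Qed.

Lemma rnormM (a b : R[i]) : rnorm (a * b) = rnorm a * rnorm b.
Proof. by apply: complexI; rewrite rmorphM/= !rnormE normrM. Qed.

Lemma rnorm_real (r : R) : rnorm (r%:C%C) = `|r|.
Proof. by apply: complexI; rewrite rnormE normc_def/= expr0n/= addr0 sqrtr_sqr. Qed.

(** A positive element of [R[i]] is real, so the epsilons of the library's convergence over [R[i]]
    are exactly the images of the positive reals. *)
Lemma cvg_rnormP (V : normedModType R[i]) (u : nat -> V) (l : V) :
  u @ \oo --> l <-> forall e : R, 0 < e -> \forall n \near \oo, rnorm (l - u n) < e.
Proof.
split=> [/cvgrPdist_lt ul e e0|ul].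
  have /ul : 0 < e%:C%C by rewrite ltcR.
  by apply: filterS => n; rewrite -rnormE ltcR.
apply/cvgrPdist_lt => e e0.
have eE : e = (complex.Re e)%:C%C by rewrite RRe_real// gtr0_real.
move: e0; rewrite eE ltcR => /ul.
by apply: filterS => n; rewrite -rnormE ltcR.
Qed.

Lemma cauchy_rnorm_cvg (V : completeNormedModType R[i]) (u : nat -> V) :
  (forall e : R, 0 < e -> exists N, forall m n, (N <= m <= n)%N ->
     rnorm (u n - u m) < e) -> cvgn u.
Proof.
move=> uc; apply/cauchy_cvgP; apply/cauchy_exP => e e0.
have eE : e = (complex.Re e)%:C%C by rewrite RRe_real// gtr0_real.
move: e0; rewrite eE ltcR => /uc [N NP].
exists (u N); exists N => // n /= Nn.
by rewrite -ball_normE/= -rnormE ltcR rnormB_sym NP// leqnn.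
Qed.

Lemma closure_rnormP (V : normedModType R[i]) (E : set V) (v : V) :
  closure E v <-> forall e : R, 0 < e -> exists2 w, E w & rnorm (v - w) < e.
Proof.
split=> [Ev e e0|Ev B /nbhs_ballP[e /= e0 eB]].
  have eC0 : 0 < e%:C%C by rewrite ltcR.
  have [w [Ew]] := Ev _ (nbhsx_ballx v _ eC0).
  by rewrite -ball_normE/= -rnormE ltcR; exists w.
have eE : e = (complex.Re e)%:C%C by rewrite RRe_real// gtr0_real.
move: (e0); rewrite eE ltcR => /Ev[w Ew vw]; exists w; split => //.
by apply: eB; rewrite eE -ball_normE/= -rnormE ltcR.
Qed.

End RealNorm.

(** * Inner product identities *)

Section Hilbert.
Context {R : realType} {X : hilbertType R}.
Implicit Types x y z : X.

Lemma inner_rnorm x : inner x x = (rnorm x ^+ 2)%:C%C.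
Proof. by rewrite inner_normE rmorphXn/= rnormE. Qed.

Lemma innerC x y : inner y x = (inner x y)^*.
Proof. by rewrite (hermC inner y x) expr0 mul1r. Qed.

(** Since [s] is real, a coefficient [s * inner x y] makes both cross terms real and equal. The
    value [s = rnorm y ^- 2] gives the projection onto the line of [y]. *)
Lemma rnormB_scale x y (s : R) :
  rnorm (x - (s%:C%C * inner x y) *: y) ^+ 2 =
  rnorm x ^+ 2 - 2 * s * rnorm (inner x y) ^+ 2 +
  s ^+ 2 * rnorm (inner x y) ^+ 2 * rnorm y ^+ 2.
Proof.
have dE : inner x ((s%:C%C * inner x y) *: y) =
    (s * rnorm (inner x y) ^+ 2)%:C%C.
  rewrite linearZr_LR/= rmorphM/= (@conj_Creal _ s%:C%C) ?complex_real// -mulrA.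
  by rewrite -(mulrC (inner x y)) -normCK rmorphM rmorphXn/= rnormE.
apply: complexI; rewrite -inner_rnorm dnormB/= dE.
rewrite (@conj_Creal _ (_)%:C%C) ?complex_real// !inner_rnorm rnormZ.
rewrite -!(rmorphD, rmorphB)/=; congr (_%:C%C).
rewrite exprMn rnormM rnorm_real exprMn -normrX ger0_norm ?sqr_ge0//.
by ring.
Qed.

Lemma parallelogram x y :
  rnorm (x + y) ^+ 2 + rnorm (x - y) ^+ 2 = 2 * (rnorm x ^+ 2 + rnorm y ^+ 2).
Proof.
apply: complexI; rewrite rmorphD/= -!inner_rnorm dnormB dnormD !inner_rnorm.
rewrite (_ : 2 = 1 + 1 :> R)// mulrDl mul1r !rmorphD/=.
by rewrite addrACA subrr addr0.
Qed.

End Hilbert.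

(** * Cauchy-Schwarz and orthogonal vectors by distance minimization *)

Section Projection.
Context {R : realType} {X : hilbertType R}.
Implicit Types x y z : X.

(** A quantitative form of the orthogonality of a minimizer. Subtracting from [z] its projection
    onto the line of [y] lowers the squared norm by [|inner z y|^2 / |y|^2], which the hypothesis
    bounds by [e ^+ 2]. *)
Lemma inner_le_almost_minimal z y (e : R) : 0 <= e ->
  (forall a, rnorm z ^+ 2 - e ^+ 2 <= rnorm (z - a *: y) ^+ 2) ->
  rnorm (inner z y) <= e * rnorm y.
Proof.
move=> e0 zy; have [->|y0] := eqVneq y 0.
  by rewrite linear0r !rnorm0 mulr0.
have ny : 0 < rnorm y.
  by rewrite lt_neqAle rnorm_ge0 andbT eq_sym; apply: contra_neq y0 => /rnorm0_eq0.
rewrite -ler_sqr ?nnegrE ?mulr_ge0 ?rnorm_ge0// exprMn.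
have := zy ((rnorm y ^- 2)%:C%C * inner z y); rewrite rnormB_scale.
set c := rnorm (inner z y) ^+ 2.
have -> : (rnorm y ^- 2) ^+ 2 * c * rnorm y ^+ 2 = rnorm y ^- 2 * c.
  by field; rewrite gt_eqF.
set q := rnorm y ^- 2 => qc.
have : q * c <= e ^+ 2 by move: qc; lra.
by rewrite mulrC ler_pdivrMr ?exprn_gt0.
Qed.

(** For [e = rnorm x], almost-minimality only says that squares are nonnegative. *)
Lemma inner_cauchy_schwarz x y : rnorm (inner x y) <= rnorm x * rnorm y.
Proof.
apply: inner_le_almost_minimal => [|a]; first exact: rnorm_ge0.
by rewrite subrr sqr_ge0.
Qed.

(** For [x] outside the closure of [M], a sequence in [M] minimizing the distance to [x] is Cauchy
    by the parallelogram law. If [p] is its limit, [x - p] is the required vector. *)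
Lemma exists_orthogonal (M : set X) : M 0 ->
  (forall a x y, M x -> M y -> M (a *: x + y)) -> closure M <> setT ->
  exists2 z, z != 0 & forall m, M m -> inner m z = 0.
Proof.
(* Here [a], [b], [c] stand for the squared distances from [x] to two approximants and to their
   midpoint, [g] for the squared gap between the approximants, and [d] for the infimum: g = 2(a + b)
   - 4c < 2(s + t) < E. *)
have mid_bound (a b c g s t d E : R) : 2 ^+ 2 * c + g = 2 * (a + b) -> d <= c ->
    a < d + s -> b < d + t -> s < E / 4 -> t < E / 4 -> g < E.
  by move=> *; lra.
move=> M0 ML; have MD x y : M x -> M y -> M (x + y).
  by move=> Mx My; rewrite -(scale1r x); exact: ML.
have MZ a x : M x -> M (a *: x) by move=> Mx; rewrite -(addr0 (a *: x)); exact: ML.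
move=> clM; have [x xM] : exists x, ~ closure M x.
  by apply/existsNP => clMT; apply: clM; rewrite -subTset => y _; exact: clMT.
pose D := [set rnorm (x - m) ^+ 2 | m in M].
have D_inf : has_inf D.
  split; first by exists (rnorm (x - 0) ^+ 2), 0.
  by exists 0 => _ [m _ <-]; exact: sqr_ge0.
pose d := inf D.
have d_le m : M m -> d <= rnorm (x - m) ^+ 2.
  by move=> Mm; apply: ge_inf; [exact: D_inf.2|exists m].
have [|u uP] := @choice nat X
    (fun n m => M m /\ rnorm (x - m) ^+ 2 < d + n.+1%:R^-1).
  move=> n; have n0 : 0 < n.+1%:R^-1 :> R by rewrite invr_gt0 ltr0n.
  by have [_ [m Mm <-] md] := inf_adherent n0 D_inf; exists m.
have small (e : R) : 0 < e -> exists N, forall n, (N <= n)%N -> n.+1%:R^-1 < e.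
  move=> e0; have [N _ NP] := near_infty_natSinv_lt (PosNum e0).
  by exists N => n /NP.
have u_cvg : cvgn u.
  apply: cauchy_rnorm_cvg => e e0.
  have [N NP] : exists N, forall n, (N <= n)%N -> n.+1%:R^-1 < e ^+ 2 / 4.
    by apply: small; rewrite divr_gt0// exprn_gt0.
  exists N => m n /andP[Nm mn]; have Nn := leq_trans Nm mn.
  have [[Mm dm] [Mn dn]] := (uP m, uP n).
  have := parallelogram (x - u m) (x - u n).
  have -> : x - u m - (x - u n) = u n - u m by rewrite opprB addrCA addrAC subrr add0r.
  have -> : x - u m + (x - u n) = 2 *: (x - 2^-1 *: (u m + u n)).
    by rewrite scalerBr scalerA divff// scale1r scaler_nat mulr2n opprD addrACA.
  rewrite rnormZ exprMn => pl.
  have d_mid : d <= rnorm (x - 2^-1 *: (u m + u n)) ^+ 2.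
    by apply/d_le/MZ/MD.
  have n2 : rnorm (2 : R[i]) = 2.
    by rewrite -(rmorph_nat (real_complex R) 2) rnorm_real ger0_norm.
  rewrite -ltr_sqr ?nnegrE ?rnorm_ge0 ?(ltW e0)//.
  by rewrite n2 in pl; apply: mid_bound pl d_mid dm dn (NP _ Nm) (NP _ Nn).
have /cvg_ex[/= p up] := u_cvg.
exists (x - p) => [|m Mm].
  apply/eqP => /subr0_eq xp; apply: xM; rewrite xp; apply/closure_rnormP => e e0.
  have /cvg_rnormP/(_ _ e0)[N _ NP] := up.
  by exists (u N); [exact: (uP N).1|exact: NP (leqnn N)].
suff zm : inner (x - p) m = 0 by rewrite innerC zm conjC0.
apply: rnorm0_eq0; apply/eqP; rewrite eq_le rnorm_ge0 andbT.
apply/ler_addgt0Pr => e e0; rewrite add0r.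
(* Chosen so that [2 * f * rnorm m <= e]; the added 1 keeps the denominator positive when
   [m = 0]. *)
pose f := e / (2 * (rnorm m + 1)).
have m1 : 0 < rnorm m + 1 by rewrite ltr_wpDl ?rnorm_ge0.
have f0 : 0 < f by rewrite divr_gt0 ?mulr_gt0.
have [N1 NP1] : exists N, forall n, (N <= n)%N -> n.+1%:R^-1 < f ^+ 2.
  by apply: small; rewrite exprn_gt0.
have /cvg_rnormP/(_ _ f0)[N2 _ NP2] := up.
pose n := maxn N1 N2.
(* The limit [p] need not lie in [M]. The vector [x - u n] is almost minimal under shifts along [m],
   and [p - u n] is small, so Cauchy-Schwarz handles it. *)
have -> : x - p = (x - u n) - (p - u n) by rewrite opprB addrA subrK.
rewrite linearBl/= (le_trans (ler_rnormD _ _))// rnormN.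
apply: (@le_trans _ _ (f * rnorm m + f * rnorm m)).
  apply: lerD.
    apply: inner_le_almost_minimal => [|a]; first exact: ltW.
    rewrite -addrA -opprD; have [Mu du] := uP n.
    apply: le_trans (d_le (u n + a *: m) _); last by apply: MD => //; exact: MZ.
    by rewrite lerBlDr (le_trans (ltW du))// lerD2l ltW// NP1// leq_maxl.
  apply: (le_trans (inner_cauchy_schwarz _ _)).
  by apply: ler_wpM2r; [exact: rnorm_ge0|exact/ltW/NP2/leq_maxr].
rewrite -mulrDl (_ : f + f = e / (rnorm m + 1)).
  by rewrite -mulrA ler_piMr ?(ltW e0)// mulrC ler_pdivrMr// mul1r lerDl.
by rewrite /f; field; rewrite gt_eqF.
Qed.
End Projection.

(** * Convergence and linearity of the synthesis operator *)

Section BesselSynthesis.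
Context {R : realType}.

Lemma bounded_op_cvg (Y Z : normedModType R[i]) (T : Y -> Z) (u : nat -> Y) (l : Y) :
  bounded_op T -> u @ \oo --> l -> (fun n => T (u n)) @ \oo --> T l.
Proof.
move=> [linT [c Tc]] /cvg_rnormP ul; apply/cvg_rnormP => e e0.
have c1 : 0 < `|c| + 1 by rewrite ltr_wpDl.
have /ul : 0 < e / (`|c| + 1) by rewrite divr_gt0.
apply: filterS => n; rewrite ltr_pdivlMr// => le_e.
have -> : T l - T (u n) = T (l - u n).
  by rewrite addrC -scaleN1r -linT scaleN1r addrC.
rewrite (le_lt_trans (Tc _))// (le_lt_trans _ le_e)// mulrC ler_wpM2l ?rnorm_ge0//.
by rewrite (le_trans (ler_norm c))// lerDl.
Qed.

Lemma ell2_tail (w : ell2 R) (e : R) : 0 < e ->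
  exists N, forall m n, (N <= m <= n)%N ->
    \sum_(m <= k < n) rnorm (w k) ^+ 2 < e.
Proof.
move=> e0; pose s := series (fun k => rnorm (w k) ^+ 2).
have s_nd : {homo s : n m / (n <= m)%N >-> n <= m}.
  by apply/nondecreasing_series => k _ _; exact: sqr_ge0.
have s_cvg : cvgn s.
  apply: nnseries_is_cvg => [k|]; first exact: sqr_ge0.
  by have := valP w; move/asboolP.
have /cvgrPdist_lt/(_ e e0)[N _ NP] := s_cvg.
exists N => m n /andP[Nm mn].
rewrite -(sub_series_geq (fun k => rnorm (w k) ^+ 2) mn) -/s.
have := NP m Nm; rewrite /= ger0_norm ?subr_ge0 ?nondecreasing_cvgn_le//.
by apply: le_lt_trans; rewrite lerB// nondecreasing_cvgn_le.
Qed.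

Lemma ell2_delta (k : nat) : exists w : ell2 R, forall j, w j = (j == k)%:R.
Proof.
have sq : (fun j : nat => (j == k)%:R : R[i]^o) \in @square_summable R.
  apply/asboolP; rewrite (nneseries_split _ k.+1)//; last first.
    by move=> n _; rewrite lee_fin sqr_ge0.
  rewrite add0n eseries0 ?adde0; last first.
    by move=> i /= ki _; rewrite gtn_eqF// rnorm0 expr0n.
  by rewrite sumEFin ltry.
by exists (Ell2 sq).
Qed.

Variable Y : hilbertType R.

(** Let [s] be the block sum. Its squared norm pairs the [w k] with the coefficients
    [inner s (eta k)], and the Bessel inequality at [s] itself controls these by
    [alpha * rnorm s ^+ 2]. *)
Lemma bessel_block (eta : nat -> Y) : bessel eta ->
  exists2 alpha : R, 0 < alpha & forall (w : nat -> R[i]) m n,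
    rnorm (\sum_(m <= k < n) w k *: eta k) ^+ 2 <=
    alpha * \sum_(m <= k < n) rnorm (w k) ^+ 2.
Proof.
move=> [alpha a0 eta_a]; exists alpha => // w m n.
set s := \sum_(_ <= k < _) _.
have sum_le : \sum_(m <= k < n) rnorm (inner s (eta k)) ^+ 2 <= alpha * rnorm s ^+ 2.
  have sq0 k : (0 <= (rnorm (inner s (eta k)) ^+ 2)%:E)%E by rewrite lee_fin sqr_ge0.
  rewrite -lee_fin (le_trans _ (eta_a s))// -sumEFin.
  apply: le_trans (nneseries_lim_ge n _); last by move=> k _ _; exact: sq0.
  have [mn|nm] := leqP m n; last by rewrite big_geq 1?ltnW// sume_ge0.
  by rewrite [leRHS](big_cat_nat (leq0n m) mn)//= leeDr// sume_ge0.
have sE : rnorm s ^+ 2 <=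
    \sum_(m <= k < n) rnorm (w k) * rnorm (inner s (eta k)).
  have -> : rnorm s ^+ 2 = rnorm (inner s s).
    by rewrite inner_rnorm rnorm_real ger0_norm// sqr_ge0.
  rewrite {2}/s linear_sumr/=.
  rewrite -lecR rnormE rmorph_sum/= (le_trans (ler_norm_sum _ _ _))//.
  apply: ler_sum => k _; rewrite linearZr_LR/= rmorphM/= !rnormE normrM.
  by rewrite norm_conjC.
(* AM-GM: 2 w f <= alpha w^2 + f^2 / alpha *)
have amgm : \sum_(m <= k < n) rnorm (w k) * rnorm (inner s (eta k)) <=
    2^-1 * (alpha * \sum_(m <= k < n) rnorm (w k) ^+ 2 +
            alpha^-1 * \sum_(m <= k < n) rnorm (inner s (eta k)) ^+ 2).
  rewrite !mulr_sumr -big_split/= mulr_sumr; apply: ler_sum => k _.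
  rewrite -subr_ge0; set a := rnorm (w k); set b := rnorm _.
  have -> : 2^-1 * (alpha * a ^+ 2 + alpha^-1 * b ^+ 2) - a * b =
    (2 * alpha)^-1 * (alpha * a - b) ^+ 2 by field; rewrite gt_eqF.
  by rewrite mulr_ge0 ?sqr_ge0// invr_ge0 mulr_ge0// ltW.
(* The coefficient half of the bound is thus at most half of [rnorm s ^+ 2] and is absorbed on the
   left, with no division by [rnorm s]. *)
have : alpha^-1 * \sum_(m <= k < n) rnorm (inner s (eta k)) ^+ 2 <= rnorm s ^+ 2.
  by rewrite ler_pdivrMl.
move: sE amgm; set A := \sum_(_ <= _ < _) _ * _; set B := alpha * _.
by set C := alpha^-1 * _; lra.
Qed.

(** The block estimate and the small tails of [w] make the partial sums Cauchy, so the [limn] in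
    [synthesis] is a genuine limit. *)
Lemma synthesis_cvg (eta : nat -> Y) (w : ell2 R) : bessel eta ->
  series (fun k => w k *: eta k) @ \oo --> synthesis eta w.
Proof.
move=> /bessel_block[alpha a0 blk]; apply: cauchy_rnorm_cvg => e e0.
have [|N NP] := ell2_tail w (e := e ^+ 2 / alpha).
  by rewrite divr_gt0// exprn_gt0.
exists N => m n Nmn; have /andP[_ mn] := Nmn.
rewrite sub_series_geq// -ltr_sqr ?nnegrE ?rnorm_ge0 ?(ltW e0)//.
apply: le_lt_trans (blk _ _ _) _.
by have := NP m n Nmn; rewrite ltr_pdivlMr// mulrC.
Qed.

Lemma synthesisE (eta : nat -> Y) (w : ell2 R) (l : Y) :
  series (fun k => w k *: eta k) @ \oo --> l -> synthesis eta w = l.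
Proof. by apply: cvg_lim; exact: norm_hausdorff. Qed.

Lemma synthesis_linear (eta : nat -> Y) : bessel eta -> linear (synthesis eta).
Proof.
move=> eta_b a v w; apply: synthesisE.
rewrite (_ : series _ = a \*: series (fun k => v k *: eta k) +
    series (fun k => w k *: eta k)).
  by apply: cvgD; [apply: cvgZl_tmp|]; exact: synthesis_cvg.
apply/funext => n; transitivity (a *: (\sum_(0 <= k < n) v k *: eta k) +
  \sum_(0 <= k < n) w k *: eta k) => //.
rewrite scaler_sumr /series/=.
rewrite (eq_bigr (fun k => a *: (v k *: eta k) + w k *: eta k)) ?big_split//.
by move=> k _; rewrite scalerDl scalerA.
Qed.

Lemma range_synthesis (eta : nat -> Y) k : range (synthesis eta) (eta k).
Proof.
have [w wE] := ell2_delta k; exists w => //; apply: synthesisE.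
apply/cvg_rnormP => e e0; exists k.+1 => // n /= kn.
rewrite /series/= (bigD1_seq k) ?iota_uniq ?mem_index_iota//= wE eqxx scale1r.
rewrite big1 ?addr0 ?subrr ?rnorm0// => j /negPf jk.
by rewrite wE jk scale0r.
Qed.

End BesselSynthesis.

(** Finite sums commute with [A] and [B], and boundedness passes to the limit. This serves both for
    [Xi1 = A Xi0 + B Ups0] and for deducing [Ups0 = K Xi0] from the termwise relation. *)
Lemma synthesis_comb (R : realType) (Y Z V : hilbertType R) (A : Y -> V) (B : Z -> V)
    (eta : nat -> Y) (theta : nat -> Z) (zeta : nat -> V) (w : ell2 R) :
  bounded_op A -> bounded_op B -> bessel eta -> bessel theta ->
  (forall k, zeta k = A (eta k) + B (theta k)) ->
  synthesis zeta w = A (synthesis eta w) + B (synthesis theta w).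
Proof.
move=> Ab Bb eta_b theta_b zetaE; apply: synthesisE.
have comb (Y' : hilbertType R) (T : Y' -> V) (f : nat -> Y') n : bounded_op T ->
    \sum_(0 <= k < n) w k *: T (f k) = T (\sum_(0 <= k < n) w k *: f k).
  move=> [linT _]; elim: n => [|n IHn].
    by rewrite !big_geq//; have := linT (-1) 0 0; rewrite !scaleN1r !addNr.
  by rewrite !big_nat_recr//= IHn addrC [in RHS]addrC linT.
rewrite (_ : series _ = (fun n => A (series (fun k => w k *: eta k) n)) +
    (fun n => B (series (fun k => w k *: theta k) n))).
  by apply: cvgD; apply: bounded_op_cvg => //; exact: synthesis_cvg.
apply/funext => n; transitivity (A (\sum_(0 <= k < n) w k *: eta k) +
  B (\sum_(0 <= k < n) w k *: theta k)) => //.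
rewrite -(comb _ A eta)// -(comb _ B theta)// /series/=.
rewrite (eq_bigr (fun k => w k *: A (eta k) + w k *: B (theta k))) ?big_split//.
by move=> k _; rewrite zetaE scalerDr.
Qed.

(** * Algebraic linear sections from Zorn's lemma *)

Lemma linear_section (R : realType) (V W : lmodType R[i]) (T : V -> W) (N : set V) :
  linear T -> N 0 -> (forall a v w, N v -> N w -> N (a *: v + w)) ->
  exists s : W -> V, linear_on (T @` N) s /\
    forall y, (T @` N) y -> N (s y) /\ T (s y) = y.
Proof.
move=> linT N0 NL.
have TB v w : T (v - w) = T v - T w by rewrite addrC -scaleN1r linT scaleN1r addrC.
have T0 : T 0 = 0 by rewrite -(subrr 0) TB subrr.
(* Subspaces of [N] on which [T] is injective. A maximal one has the same image as [N], and
   inverting [T] on it gives the section. The empty set also satisfies [P], which covers the empty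
   chain. *)
pose P (D : set V) := [/\ D `<=` N,
  forall a v w, D v -> D w -> D (a *: v + w) & forall v, D v -> T v = 0 -> v = 0].
have [|D [[DN DL D_inj] D_max]] := @Zorn_bigcup _ P.
  move=> F FP F_tot; split.
  - by move=> v [D FD Dv]; have [DN _ _] := FP _ FD; exact: DN.
  - move=> a v w [D FD Dv] [D' FD' D'w].
    have [DD'|D'D] := F_tot _ _ FD FD'.
      by exists D' => //; have [_ DL _] := FP _ FD'; apply: DL => //; exact: DD'.
    by exists D => //; have [_ DL _] := FP _ FD; apply: DL => //; exact: D'D.
  - by move=> v [D FD Dv]; have [_ _ D_inj] := FP _ FD; exact: D_inj.
(* A [D] without 0 would be empty, and the zero subspace would strictly contain it. *)
have D0 : D 0.
  apply: contrapT => D0; apply: (D_max [set 0]); last first.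
    split=> [_ ->|a v w -> ->|v ->]//.
    by rewrite scaler0 addr0.
  have De v : ~ D v by move=> Dv; apply: D0; rewrite -(addNr v) -scaleN1r; exact: DL.
  by split=> [v /De//|/(_ 0 erefl)/De].
have D_onto v : N v -> exists2 d, D d & T d = T v.
  move=> Nv; apply: contrapT => Tv.
  (* If [T v] were missed by [D], adjoining the line of [v] would keep [T] injective and contradict
     maximality. *)
  pose D' := [set w | exists a, exists2 d, D d & w = a *: v + d].
  apply: (D_max D').
    split=> [d Dd|D'D]; first by exists 0, d => //; rewrite scale0r add0r.
    apply: Tv; exists v => //; apply: D'D.
    by exists 1, 0 => //; rewrite scale1r addr0.
  split=> [_ [a [d Dd ->]]|a _ _ [b [d Dd ->]] [c [e De ->]]|_ [a [d Dd ->]]].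
  - by apply: NL => //; exact: DN.
  - exists (a * b + c), (a *: d + e); first exact: DL.
    by rewrite scalerDr scalerDl scalerA addrACA.
  - have [->|a0] := eqVneq a 0.
      by rewrite scale0r add0r; exact: D_inj.
    rewrite linT => Tad; exfalso; apply: Tv; exists ((- a^-1) *: d).
      by rewrite -(addr0 (_ *: d)); exact: DL.
    apply: (scalerI a0); rewrite -(addr0 (_ *: d)) linT T0 addr0 scalerA mulrN.
    by rewrite mulfV// scaleN1r; apply/eqP; rewrite eq_sym -addr_eq0 Tad.
have [y|s sP] := @choice W V (fun y d => (T @` N) y -> D d /\ T d = y).
  have [[v Nv <-]|Ny] := pselect ((T @` N) y); last by exists 0 => /Ny.
  by have [d Dd Tdv] := D_onto v Nv; exists d.
exists s; split=> [a x y Tx Ty|y Ty]; last first.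
  by have [Ds Ts] := sP y Ty; split => //; exact: DN.
have [[Dx Txx] [Dy Tyy]] := (sP x Tx, sP y Ty).
have [|Dxy Txy] := sP (a *: x + y).
  case: Tx Ty => [v Nv <-] [w Nw <-]; exists (a *: v + w); first exact: NL.
  exact: linT.
(* Both sides lie in [D] and have the same image, so injectivity of [T] on [D] identifies them. *)
apply/eqP; rewrite -subr_eq0; apply/eqP/D_inj.
  by rewrite addrC -scaleN1r; apply: (DL) => //; exact: DL.
by rewrite TB linT Txx Tyy Txy subrr.
Qed.

(** * Bounded operators and the operator norm *)

Section BoundedOperators.
Context {R : realType}.
Implicit Types Y Z V : normedModType R[i].

Lemma bounded_op0 Y Z : bounded_op (fun _ : Y => 0 : Z).
Proof.
by split=> [a x y|]; [rewrite scaler0 addr0|exists 0 => y; rewrite rnorm0 mul0r].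
Qed.

Lemma bounded_opD Y Z (S T : Y -> Z) :
  bounded_op S -> bounded_op T -> bounded_op (fun y => S y + T y).
Proof.
move=> [linS [c Sc]] [linT [d Td]]; split=> [a x y|].
  by rewrite linS linT scalerDr addrACA.
by exists (c + d) => y; rewrite mulrDl (le_trans (ler_rnormD _ _))// lerD.
Qed.

Lemma bounded_opZ Y Z (b : R[i]) (T : Y -> Z) :
  bounded_op T -> bounded_op (fun y => b *: T y).
Proof.
move=> [linT [c Tc]]; split=> [a x y|].
  by rewrite linT scalerDr !scalerA mulrC.
by exists (rnorm b * c) => y; rewrite rnormZ -mulrA ler_wpM2l// rnorm_ge0.
Qed.

Lemma bounded_op_comp Y Z V (S : Z -> V) (T : Y -> Z) :
  bounded_op S -> bounded_op T -> bounded_op (fun y => S (T y)).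
Proof.
move=> [linS [c Sc]] [linT [d Td]]; split=> [a x y|]; first by rewrite linT linS.
exists (`|c| * d) => y; rewrite (le_trans (Sc _))// -mulrA.
by rewrite (le_trans (ler_wpM2r (rnorm_ge0 _) (ler_norm c)))// ler_wpM2l.
Qed.

Lemma bounded_opB Y Z (S T : Y -> Z) :
  bounded_op S -> bounded_op T -> bounded_op (fun y => S y - T y).
Proof.
move=> Sb /(bounded_opZ (-1)) Tb; have := bounded_opD Sb Tb.
by congr bounded_op; apply/funext => y; rewrite scaleN1r.
Qed.

Lemma linear_zero (Y Z : lmodType R[i]) (T : Y -> Z) : linear T -> T 0 = 0.
Proof. by move=> linT; rewrite -(addNr 0) -scaleN1r linT scaleN1r addNr. Qed.

Lemma linear_scale (Y Z : lmodType R[i]) (T : Y -> Z) a y :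
  linear T -> T (a *: y) = a *: T y.
Proof. by move=> linT; rewrite -(addr0 (a *: y)) linT linear_zero// addr0. Qed.

Lemma bounded_op_dense_eq Y Z (S T : Y -> Z) (D : set Y) :
  bounded_op S -> bounded_op T -> closure D = setT ->
  (forall y, D y -> S y = T y) -> forall y, S y = T y.
Proof.
move=> Sb Tb clD ST y; apply/eqP; rewrite -subr_eq0; apply/eqP/rnorm0_eq0.
apply/eqP; rewrite eq_le rnorm_ge0 andbT; apply/ler_addgt0Pr => e e0; rewrite add0r.
have [linB [c Bc]] := bounded_opB Sb Tb.
have c1 : 0 < `|c| + 1 by rewrite ltr_wpDl.
have /closure_rnormP/(_ (e / (`|c| + 1))) : closure D y by rewrite clD.
rewrite divr_gt0// => /(_ isT)[w Dw]; rewrite ltr_pdivlMr// => yw.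
have -> : S y - T y = S (y - w) - T (y - w).
  have := linB (-1) w y; rewrite /= (ST w Dw) subrr scaler0 add0r => <-.
  by rewrite scaleN1r (addrC _ y).
rewrite (le_trans (Bc _))// (le_trans _ (ltW yw))// mulrC ler_wpM2l ?rnorm_ge0//.
by rewrite (le_trans (ler_norm c))// lerDl.
Qed.

Lemma le_opnorm Y Z (T : Y -> Z) y : bounded_op T -> rnorm y <= 1 ->
  rnorm (T y) <= opnorm T.
Proof.
move=> [_ [c Tc]] y1; apply: ub_le_sup; last by exists y.
exists `|c| => _ [z /= z1 <-]; rewrite (le_trans (Tc z))//.
rewrite (le_trans (ler_wpM2r (rnorm_ge0 _) (ler_norm c)))//.
by rewrite -[leRHS]mulr1 ler_wpM2l.
Qed.

(** On the unit ball, [|t| * rnorm (T y)] is at most [C + rnorm (S y)] for every real [t], which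
    forces [T y = 0]; scaling reaches the other vectors. *)
Lemma opnorm_affine_bounded Y Z (S T : Y -> Z) (C : R) :
  bounded_op S -> bounded_op T ->
  (forall t : R, opnorm (fun y => S y + t%:C%C *: T y) <= C) ->
  forall y, T y = 0.
Proof.
move=> Sb Tb ST_C.
suff unit y : rnorm y <= 1 -> T y = 0.
  move=> y; have [y1|y1] := leP (rnorm y) 1; first exact: unit.
  have y0 : 0 < rnorm y by rewrite (lt_trans _ y1).
  have : T ((rnorm y)^-1%:C%C *: y) = 0.
    apply: unit; rewrite rnormZ rnorm_real ger0_norm ?invr_ge0 ?rnorm_ge0//.
    by rewrite mulVf// gt_eqF.
  rewrite linear_scale; last by case: Tb.
  move/eqP; rewrite scaler_eq0 => /orP[|/eqP//].
  by rewrite eq_complex/= eqxx andbT invr_eq0 gt_eqF.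
move=> y1; apply/rnorm0_eq0/eqP; rewrite eq_le rnorm_ge0 andbT leNgt; apply/negP => Ty.
(* With this [t], [t * rnorm (T y)] exceeds the permitted bound by exactly 1. As the sign of [C] is
   unknown, [t] is compared with its absolute value below. *)
pose t := (C + rnorm (S y) + 1) / rnorm (T y).
have := le_trans (le_opnorm (bounded_opD Sb (bounded_opZ t%:C%C Tb)) y1) (ST_C t).
have : rnorm (t%:C%C *: T y) <= rnorm (S y + t%:C%C *: T y) + rnorm (S y).
  by rewrite -[X in rnorm X <= _](addKr (S y)) addrC (le_trans (ler_rnormD _ _))// rnormN.
rewrite rnormZ rnorm_real.
have : t * rnorm (T y) <= `|t| * rnorm (T y) by rewrite ler_wpM2r ?rnorm_ge0// ler_norm.
rewrite {1}/t divfK ?gt_eqF//.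
set a := `|t| * _; set b := rnorm (S y + _); lra.
Qed.

End BoundedOperators.

(** * Consequences of having a stabilizing gain *)

Section StabilizingGains.
Context {R : realType} {X U : hilbertType R}.
Variables (x1 x0 : nat -> X) (u0 : nat -> U) (gamma : R).

Lemma gain_annihilator (K : X -> U) (A L1 : X -> X) (B L2 : U -> X) :
  stabilizing_gain gamma x1 x0 u0 K -> Sigma_is x1 x0 u0 (A, B) ->
  bounded_op L1 -> bounded_op L2 ->
  (forall k, L1 (x0 k) + L2 (u0 k) = 0) ->
  forall y, L1 y + L2 (K y) = 0.
Proof.
move=> [Kb [M _ KM]] [/= Ab Bb AB] L1b L2b L0.
apply: (@opnorm_affine_bounded _ _ _ (fun y => A y + B (K y)) _ (M * gamma)).
- by apply: bounded_opD => //; exact: bounded_op_comp Bb Kb.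
- by apply: bounded_opD => //; exact: bounded_op_comp L2b Kb.
move=> t.
(* The perturbed pair still explains the data, and the decay bound at the first power is
   [M * gamma], uniformly in [t]. *)
have [|/= _ _ /(_ 1%N)] := KM (fun y => A y + t%:C%C *: L1 y, fun v => B v + t%:C%C *: L2 v).
  split=> [||k /=]; [by apply: bounded_opD => //; exact: bounded_opZ..|].
  by rewrite addrACA -scalerDr L0 scaler0 addr0.
rewrite expr1 /=; congr (opnorm _ <= _); apply/funext => y /=.
by rewrite scalerDr addrACA.
Qed.

Lemma stabilizing_gain_dense_range (K : X -> U) (A : X -> X) (B : U -> X) :
  stabilizing_gain gamma x1 x0 u0 K -> Sigma_is x1 x0 u0 (A, B) -> bessel x0 ->
  closure (range (synthesis x0)) = setT.
Proof.
move=> Kstab AB x0b; apply: contrapT => cl.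
have lin := synthesis_linear x0b.
have [|a _ _ [v _ <-] [w _ <-]|z z0 zorth] := exists_orthogonal _ _ cl.
- by exists 0 => //; exact: linear_zero.
- by exists (a *: v + w) => //; exact: lin.
have L1b : bounded_op (fun y => inner y z *: z).
  split=> [a x y|]; first by rewrite linearPl/= scalerDl scalerA.
  exists (rnorm z * rnorm z) => y; rewrite rnormZ.
  by rewrite mulrAC ler_wpM2r ?rnorm_ge0// mulrC inner_cauchy_schwarz.
(* At [y = z] the identity reads [|z|^2 z = 0]. *)
have /(_ z)/eqP : forall y, inner y z *: z + 0 = 0.
  apply: (gain_annihilator Kstab AB L1b (bounded_op0 U X)) => k.
  by rewrite zorth ?scale0r ?addr0//; exact: range_synthesis.
rewrite addr0 scaler_eq0 (negPf z0) orbF inner_rnorm => /eqP[/eqP].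
by rewrite sqrf_eq0 => /eqP/rnorm0_eq0/eqP; rewrite (negPf z0).
Qed.

Lemma noninformative_gain (K : X -> U) (A A' : X -> X) (B B' : U -> X) :
  one_dimensional U -> stabilizing_gain gamma x1 x0 u0 K ->
  Sigma_is x1 x0 u0 (A, B) -> Sigma_is x1 x0 u0 (A', B') -> (A', B') <> (A, B) ->
  forall k, u0 k = K (x0 k).
Proof.
move=> [e e0 Ue] Kstab AB AB' neq.
have [/= Ab Bb ABk] := AB; have [/= A'b B'b AB'k] := AB'.
have L2b := bounded_opB B'b Bb; have [linL2 _] := L2b.
pose L2 v := B' v - B v.
have L0 k : A' (x0 k) - A (x0 k) + L2 (u0 k) = 0.
  by rewrite addrACA -AB'k -opprD -ABk subrr.
have LK := gain_annihilator Kstab AB (bounded_opB A'b Ab) L2b L0.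
(* If [L2 e = 0], then [L2] vanishes on the line [U], so [B' = B], and [LK] then yields [A' = A], a
   contradiction. *)
have L2e : L2 e != 0.
  apply: contra_notN neq => /eqP L2e.
  have L20 v : L2 v = 0.
    by have [a ->] := Ue v; rewrite /L2 (linear_scale a e linL2) -/(L2 e) L2e scaler0.
  congr pair; apply/funext => y; apply/eqP; rewrite -subr_eq0; last by rewrite -/(L2 _) L20.
  by have := LK y; rewrite -/(L2 _) L20 addr0 => ->.
move=> k; apply/eqP; rewrite -subr_eq0.
have [a aE] := Ue (u0 k - K (x0 k)).
(* [L0] at [k] and [LK] at [x0 k] share their first summand, so their second summands agree. *)
have : L2 (u0 k - K (x0 k)) = 0.
  have -> : L2 (u0 k - K (x0 k)) = L2 (u0 k) - L2 (K (x0 k)).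
    by rewrite addrC -scaleN1r [LHS]linL2 scaleN1r addrC.
  apply/eqP; rewrite subr_eq0; apply/eqP.
  by apply: (addrI (A' (x0 k) - A (x0 k))); rewrite L0 LK.
rewrite aE /L2 (linear_scale a e linL2) -/(L2 e) => /eqP.
by rewrite !scaler_eq0 (negPf L2e) orbF => ->.
Qed.

Lemma gain_adjustment (Xi0 : ell2 R -> X) (Ups0 : ell2 R -> U) (K : X -> U) :
  one_dimensional U -> linear Xi0 -> linear Ups0 ->
  ker Xi0 `\` ker Ups0 !=set0 ->
  forall w, exists2 v, Xi0 v = Xi0 w & Ups0 v = K (Xi0 v).
Proof.
move=> [e e0 Ue] linXi linUps [w0 [/= Xiw0 /eqP Upsw0]] w.
(* In coordinates along [e], [Ups0 w0] is [a] and the defect [K (Xi0 w) - Ups0 w] is [b]; adding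
   [b / a] times [w0] to [w] removes the defect. *)
have [a aE] := Ue (Ups0 w0); have [b bE] := Ue (K (Xi0 w) - Ups0 w).
have a0 : a != 0 by apply: contra_neq Upsw0 => a0; rewrite aE a0 scale0r.
have Xiv : Xi0 ((b / a) *: w0 + w) = Xi0 w by rewrite linXi Xiw0 scaler0 add0r.
exists ((b / a) *: w0 + w) => //.
by rewrite Xiv linUps aE scalerA divfK// -bE subrK.
Qed.

End StabilizingGains.

(** * The correspondence between stabilizing gains and admissible right inverses *)

Unset Implicit Arguments.
Set Strict Implicit.

Theorem mainTheorem3 (R : realType) (X U : hilbertType R)
    (X_nontrivial : nontrivial X) (U_nontrivial : nontrivial U)
    (dimU : one_dimensional U)
    (As : X -> X) (Bs : U -> X)
    (As_bounded : bounded_op As) (Bs_bounded : bounded_op Bs)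
    (x1 x0 : nat -> X) (u0 : nat -> U)
    (x1_bessel : bessel x1) (x0_bessel : bessel x0) (u0_bessel : bessel u0)
    (data : forall k, x1 k = As (x0 k) + Bs (u0 k))
    (Xi1 Xi0 : ell2 R -> X) (Ups0 : ell2 R -> U)
    (Xi1E : Xi1 = synthesis x1) (Xi0E : Xi0 = synthesis x0)
    (Ups0E : Ups0 = synthesis u0)
    (cond : ker Xi0 `\` ker Ups0 !=set0 \/
            ~ informative_for_identification As Bs x1 x0 u0)
    (gamma : R) (gamma_gt0 : 0 < gamma) (gamma_lt1 : gamma < 1) :
  (forall Xi0d : X -> ell2 R, admissible gamma Xi1 Xi0 Ups0 Xi0d ->
     forall K : X -> U, bounded_extension (range Xi0) (Ups0 \o Xi0d) K ->
       stabilizing_gain gamma x1 x0 u0 K) /\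
  (forall K : X -> U, stabilizing_gain gamma x1 x0 u0 K ->
     exists2 Xi0d : X -> ell2 R, admissible gamma Xi1 Xi0 Ups0 Xi0d &
       bounded_extension (range Xi0) (Ups0 \o Xi0d) K).
Proof.
have Xi1_comb A B w : Sigma_is x1 x0 u0 (A, B) -> Xi1 w = A (Xi0 w) + B (Ups0 w).
  by move=> [/= Ab Bb ABk]; rewrite Xi1E Xi0E Ups0E; exact: synthesis_comb.
have AsBs : Sigma_is x1 x0 u0 (As, Bs) by [].
have linXi0 : linear Xi0 by rewrite Xi0E; exact: synthesis_linear.
have linUps0 : linear Ups0 by rewrite Ups0E; exact: synthesis_linear.
split=> [Xi0d [_ clXi0 Xi0dK _ [F [Fb FE] [M M1 FM]]] K [Kb KE]|K Kstab].
  split=> //; exists M => // -[A B] AB; have [/= Ab Bb _] := AB.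
  (* Every closed loop equals the same [F], so the constant [M] of [F] serves all of [Sigma_is]. *)
  split=> // k; suff -> : A \+ (B \o K) = F by [].
  apply/funext; apply: (bounded_op_dense_eq _ Fb clXi0).
    by apply: bounded_opD => //; exact: bounded_op_comp Bb Kb.
  by move=> x Xx; rewrite FE//= (Xi1_comb _ _ _ AB) Xi0dK// KE.
have [Kb [M M1 KM]] := Kstab; have [linK _] := Kb.
have [_ _ /= AsBsM] := KM _ AsBs.
have adj w : exists2 v, Xi0 v = Xi0 w & Ups0 v = K (Xi0 v).
  case: cond => [kerP|ninf]; first exact: gain_adjustment.
  have [[A B] AB neq] : exists2 AB, Sigma_is x1 x0 u0 AB & AB <> (As, Bs).
    apply: contrapT => noAB; apply: ninf; apply/seteqP; split=> [AB AB_is|_ -> //].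
    by apply: contrapT => neq; apply: noAB; exists AB.
  have u0K := noninformative_gain dimU Kstab AsBs AB neq.
  (* No correction of [w] is needed here: [u0 k = K (x0 k)] passes to the synthesis operators, with
     [K] and the zero operator as coefficients. *)
  exists w => //; rewrite Ups0E Xi0E -[RHS]addr0.
  apply: (@synthesis_comb _ _ _ _ K (fun _ : U => 0) x0 u0) => //.
    exact: bounded_op0.
  by move=> k; rewrite addr0.
pose N := [set w | Ups0 w = K (Xi0 w)].
have N_onto : Xi0 @` N = range Xi0.
  apply/seteqP; split=> _ [w _ <-]; first by exists w.
  by have [v Xiv Upsv] := adj w; exists v.
have [||s [s_lin sP]] := @linear_section _ _ _ Xi0 N linXi0.
- by rewrite /N /= !linear_zero.
- by move=> a v w Nv Nw; rewrite /N /= linUps0 Nv Nw linXi0 linK.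
rewrite N_onto in s_lin sP.
have sK : bounded_extension (range Xi0) (Ups0 \o s) K.
  by split=> // x Xx; have [/= -> ->] := sP x Xx.
exists s => //; split=> //.
- by rewrite Xi0E; exact: stabilizing_gain_dense_range Kstab AsBs x0_bessel.
- by move=> x /sP[].
- by exists K.
(* The required extension is the true closed loop: the data bound it through [AsBsM], and on the
   range of [Xi0] the relations [Xi0 (s x) = x] and [Ups0 (s x) = K x] identify it with
   [Xi1 \o s]. *)
exists (As \+ (Bs \o K)); last by exists M.
split=> [|x Xx]; first by apply: bounded_opD => //; exact: bounded_op_comp Bs_bounded Kb.
by rewrite /= (Xi1_comb _ _ _ AsBs); have [/= -> ->] := sP x Xx.
Qed.
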